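(* Let $a=a(n)$ and $k=k(n)$ be positive integers (functions of $n$), and consider the $(a:b)$ minimum-degree-$k$ Maker-Breaker game on $K_n$ with Breaker moving first. (i) If $a=o\left(\sqrt{\frac{n}{\ln n}}\right)$ and $k=o(\ln n)$, then the asymptotically optimal threshold bias for this game is $\frac{an}{a+\ln n}$. (ii) If $a=\Omega\left(\sqrt{\frac{n}{\ln n}}\right)$ and $k=o(a)$, then the asymptotically optimal threshold bias for this game is $n$.
   Context: The $(a:b)$ minimum-degree-$k$ Maker-Breaker game on $K_n$: the board is the edge set of the complete graph $K_n$ on $n$ vertices. In each round Breaker first claims $b$ previously unclaimed edges, then Maker claims $a$ previously unclaimed edges (if fewer edges remain, a player claims all remaining ones). Maker wins if at the end of the game his edges form a spanning subgraph of minimum degree at least $k$; otherwise Breaker wins. A function $\beta(n)$ is the asymptotically optimal threshold bias if for every $\varepsilon>0$ there is $n_0$ such that for every $n\ge n_0$: Maker has a winning strategy for every positive integer $b\le(1-\varepsilon)\beta(n)$, and Breaker has a winning strategy for every integer $b\ge(1+\varepsilon)\beta(n)$.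
   Formalization: In (ii) the additional hypothesis k = o(n) is assumed; without it the claim fails, e.g. for a = (n+1)^2, k = n+1, and it is necessary for the conclusion (it follows from k = o(a) when a = O(n)). *)

(* Defs.v *)
From mathcomp Require Import all_boot all_order all_algebra reals.

Set Implicit Arguments.
Unset Strict Implicit.
Unset Printing Implicit Defensive.

Import Order.TTheory GRing.Theory Num.Theory.

(** * Biased Maker-Breaker games *)

(* A history lists the moves made so far, oldest first; a move is the set of
   edges it claims. Breaker makes the moves of even index, Maker those of odd
   index. A strategy sees the whole history. *)
Definition history (T : finType) : Type := seq {set T}.
Definition strategy (T : finType) : Type := history T -> {set T}.

Definition player : Type := bool.
Definition Breaker : player := false.
Definition Maker : player := true.

Definition to_move (T : finType) (h : history T) : player := odd (size h).

Definition claimed (T : finType) (p : player) (h : history T) : {set T} :=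
  \bigcup_(i < size h | odd i == p) nth set0 h i.

Definition unclaimed (T : finType) (board : {set T}) (h : history T) :
    {set T} :=
  board :\: (claimed Breaker h :|: claimed Maker h).

(* The bias of the player to move: a for Maker, b for Breaker. *)
Definition quota (T : finType) (a b : nat) (h : history T) : nat :=
  if to_move h then a else b.

Definition legal_move (T : finType) (board : {set T}) (a b : nat)
    (h : history T) (S : {set T}) : Prop :=
  S \subset unclaimed board h /\
  #|S| = minn (quota a b h) #|unclaimed board h|.

Definition legal_history (T : finType) (board : {set T}) (a b : nat)
    (h : history T) : Prop :=
  forall i, (i < size h)%N ->
    legal_move board a b (take i h) (nth set0 h i).

(* Once no edge is left, the only legal moves are empty, so a finished history
   may be extended by empty moves; these do not affect the outcome. *)
Definition finished (T : finType) (board : {set T}) (a b : nat)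
    (h : history T) : Prop :=
  legal_history board a b h /\ unclaimed board h = set0.

Definition legal_strategy (T : finType) (board : {set T}) (a b : nat)
    (p : player) (s : strategy T) : Prop :=
  forall h, legal_history board a b h -> to_move h = p ->
    legal_move board a b h (s h).

Definition follows (T : finType) (p : player) (s : strategy T)
    (h : history T) : Prop :=
  forall i, (i < size h)%N -> to_move (take i h) = p ->
    nth set0 h i = s (take i h).

(* [goal G] says that the set G of Maker's edges at the end of the game is a
   win for Maker. *)
Definition maker_has_winning_strategy (T : finType) (board : {set T})
    (goal : {set T} -> Prop) (a b : nat) : Prop :=
  exists s : strategy T,
    legal_strategy board a b Maker s /\
    forall h, finished board a b h -> follows Maker s h ->
      goal (claimed Maker h).

Definition breaker_has_winning_strategy (T : finType) (board : {set T})
    (goal : {set T} -> Prop) (a b : nat) : Prop :=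
  exists s : strategy T,
    legal_strategy board a b Breaker s /\
    forall h, finished board a b h -> follows Breaker s h ->
      ~ goal (claimed Maker h).

(** * The minimum-degree game on the complete graph *)

Definition complete_graph (n : nat) : {set {set 'I_n}} :=
  [set e : {set 'I_n} | #|e| == 2].

Definition degree (n : nat) (G : {set {set 'I_n}}) (v : 'I_n) : nat :=
  #|[set e in G | v \in e]|.

Definition min_degree_ge (n k : nat) (G : {set {set 'I_n}}) : Prop :=
  forall v : 'I_n, (k <= degree G v)%N.

Definition maker_wins_min_degree (n k a b : nat) : Prop :=
  maker_has_winning_strategy (complete_graph n) (@min_degree_ge n k) a b.

Definition breaker_wins_min_degree (n k a b : nat) : Prop :=
  breaker_has_winning_strategy (complete_graph n) (@min_degree_ge n k) a b.

(** * Threshold bias *)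

Local Open Scope ring_scope.

(* The board size n ranges over nat, and so do the biases: for the nonnegative
   functions beta in use, the integers b >= (1 + eps) * beta n are naturals. *)
Definition asymptotically_optimal_threshold_bias (R : realType)
    (maker_wins breaker_wins : nat -> nat -> Prop) (beta : nat -> R) : Prop :=
  forall eps : R, 0 < eps ->
  exists n0 : nat, forall n : nat, (n0 <= n)%N ->
    (forall b : nat, (0 < b)%N -> b%:R <= (1 - eps) * beta n ->
       maker_wins n b) /\
    (forall b : nat, (1 + eps) * beta n <= b%:R -> breaker_wins n b).

Definition min_degree_threshold_bias (R : realType) (a k : nat -> nat)
    (beta : nat -> R) : Prop :=
  asymptotically_optimal_threshold_bias
    (fun n b => maker_wins_min_degree n (k n) (a n) b)
    (fun n b => breaker_wins_min_degree n (k n) (a n) b)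
    beta.

(* Main.v *)
(** Maker's strategy.  With D = 2b/a, call d_B(v) - D d_M(v) the danger of v,
    and let Maker repeatedly claim an edge at a most dangerous vertex among
    those of Maker-degree less than k.  The invariant bounds, for every set J
    of such vertices, the average danger over J by a function of j = |J| which
    grows from about 0 at j = n to (b/a) ln n + o(n) at j = 1.  An edge claimed
    inside the set lowers the average by D/j; otherwise the chosen vertex can
    be added to J without lowering its average, so that the bound for j + 1
    applies.  A Breaker edge inside J counts twice for its danger.  For
    j > m = delta n this costs only (b/a) O(1) in total, the harmonic sum from
    m to n being bounded; for j <= m one counts such edges once, at the price
    of adding 1 to the average whenever j grows by 1, hence at most m.
    At j = 1, Breaker's degree stays below
    b + (b/a)(ln n + 2k + O(1)) + delta n, which is less than n - 1 - k.

    Breaker's strategy (Chvatal and Erdos).  Breaker builds a clique of about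
    a n^(1-delta) vertices untouched by Maker, then plays the box game on the
    stars of its vertices: each Maker edge touches at most one vertex of the
    clique, so spreading the b edges evenly over the surviving stars fills one
    of them if b (1 + ln(n)/a) exceeds (1 + eps) n.  When a > ln(n)/eps, the
    bias b is at least n and Breaker claims a whole star at once. *)

Require Import Defs.
From mathcomp Require Import all_boot all_order all_algebra.
From mathcomp Require Import all_classical all_reals all_analysis.
From mathcomp Require Import fintype finset zify ring lra.

Set Implicit Arguments.
Unset Strict Implicit.
Unset Printing Implicit Defensive.

Import Order.TTheory GRing.Theory Num.Theory.
Import numFieldNormedType.Exports.
Local Open Scope ring_scope.

(** * Strategies from invariants *)

Lemma claimed_rcons (T : finType) (p : player) (h : history T) (S : {set T}) :
  claimed p (rcons h S) =
  if to_move h == p then claimed p h :|: S else claimed p h.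
Proof.
rewrite /claimed size_rcons big_mkcond big_ord_recr /= nth_rcons ltnn eqxx.
under [X in X :|: _]eq_bigr => i _ do rewrite nth_rcons ltn_ord /=.
by rewrite -big_mkcond -/(to_move h); case: ifP => // _; rewrite setU0.
Qed.

Lemma to_move_rcons (T : finType) (h : history T) (S : {set T}) :
  to_move (rcons h S) = ~~ to_move h.
Proof. by rewrite /to_move size_rcons. Qed.

Lemma legal_history_rcons (T : finType) (board : {set T}) (a b : nat)
    (h : history T) (S : {set T}) :
  legal_history board a b (rcons h S) <->
  legal_history board a b h /\ legal_move board a b h S.
Proof.
split=> [leg|[legh legS] i].
  split=> [i ltih|].
    have := leg i; rewrite size_rcons nth_rcons ltih -cats1 takel_cat 1?ltnW //.
    by apply.
  have := leg (size h); rewrite size_rcons nth_rcons ltnn eqxx -cats1.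
  by rewrite take_size_cat //; apply.
rewrite size_rcons ltnS leq_eqVlt => /orP[/eqP->|ltih].
  by rewrite nth_rcons ltnn eqxx -cats1 take_size_cat.
by rewrite nth_rcons ltih -cats1 takel_cat 1?ltnW //; apply: legh.
Qed.

Lemma follows_rcons (T : finType) (p : player) (s : strategy T)
    (h : history T) (S : {set T}) :
  follows p s (rcons h S) ->
  follows p s h /\ (to_move h = p -> S = s h).
Proof.
move=> fol; split=> [i ltih tm|tm].
  have := fol i; rewrite size_rcons nth_rcons ltih -cats1 takel_cat 1?ltnW //.
  by apply.
have := fol (size h); rewrite size_rcons nth_rcons ltnn eqxx -cats1.
by rewrite take_size_cat //; apply.
Qed.

Lemma exists_between_card (T : finType) (A U : {set T}) (q : nat) :
  A \subset U -> (#|A| <= q <= #|U|)%N ->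
  exists S : {set T}, [/\ A \subset S, S \subset U & #|S| = q].
Proof.
move=> AU; elim: q => [|q IH] /andP[Aq qU].
  exists A; split=> //; lia.
case: (ltnP q #|A|) => [qA|Aq'].
  exists A; split=> //; lia.
have [|S [AS SU Sq]] := IH; first by rewrite Aq' ltnW.
have : S \proper U by rewrite properEcard SU Sq.
case/properP=> _ [x xU xS]; exists (x |: S); split.
- exact: subset_trans AS (subsetUr _ _).
- by rewrite subUset sub1set xU SU.
- by rewrite cardsU1 xS Sq.
Qed.

(** A strategy has only to name the edges that matter; the rest of the quota is filled with
    arbitrary free edges. *)
Lemma exists_legal_move (T : finType) (board : {set T}) (a b : nat)
    (h : history T) (A : {set T}) :
  A \subset unclaimed board h -> (#|A| <= quota a b h)%N ->
  exists S : {set T}, A \subset S /\ legal_move board a b h S.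
Proof.
move=> AU Aq.
have [|S [AS SU Sq]] := exists_between_card AU
    (q := minn (quota a b h) #|unclaimed board h|).
  by rewrite leq_min Aq subset_leq_card //= geq_minr.
by exists S.
Qed.

(** Choice makes a strategy of the moves that keep the invariant. A legal strategy must also answer
    legal histories where [Inv] fails; any legal move is taken there. *)
Lemma strategy_of_invariant (T : finType) (board : {set T}) (a b : nat)
    (p : player) (Inv : history T -> Prop) :
  Inv [::] ->
  (forall h, legal_history board a b h -> Inv h -> to_move h = p ->
     exists S : {set T}, legal_move board a b h S /\ Inv (rcons h S)) ->
  (forall h, legal_history board a b h -> Inv h -> to_move h <> p ->
     forall S : {set T}, legal_move board a b h S -> Inv (rcons h S)) ->
  exists s : strategy T, legal_strategy board a b p s /\
    forall h, legal_history board a b h -> follows p s h -> Inv h.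
Proof.
move=> Inv0 Invp Invnp.
have ex h : exists S : {set T}, (legal_history board a b h -> to_move h = p ->
    legal_move board a b h S /\ (Inv h -> Inv (rcons h S))).
  case: (pselect (legal_history board a b h /\ to_move h = p)) => [[lh tm]|no].
    case: (pselect (Inv h)) => [Ih|nIh].
      by have [S [? ?]] := Invp h lh Ih tm; exists S.
    have [|//|S [_ ?]] := @exists_legal_move _ board a b h set0;
      rewrite ?sub0set ?cards0 //.
    by exists S.
  by exists set0 => lh tm; case: no.
have [s sP] := choice ex.
exists s; split=> [h lh tm|h]; first by have [] := sP h lh tm.
elim/last_ind: h => [//|h S IH].
move=> /legal_history_rcons[lh lS] /follows_rcons[fh fS].
have Ih := IH lh fh.
case: (pselect (to_move h = p)) => [tm|ntm]; last exact: Invnp.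
by rewrite (fS tm); have [_] := sP h lh tm; apply.
Qed.

(** * Breaker's side *)

Lemma claimed_sub_board (T : finType) (board : {set T}) (a b : nat)
    (p : player) (h : history T) :
  legal_history board a b h -> claimed p h \subset board.
Proof.
elim/last_ind: h => [_|h S IH /legal_history_rcons[lh [SU _]]].
  by rewrite /claimed big_ord0 sub0set.
rewrite claimed_rcons; case: ifP => _; last exact: IH.
rewrite subUset IH //=; apply: subset_trans SU _; exact: subsetDl.
Qed.

Lemma claimed_disjoint (T : finType) (board : {set T}) (a b : nat)
    (h : history T) :
  legal_history board a b h -> [disjoint claimed Maker h & claimed Breaker h].
Proof.
elim/last_ind: h => [_|h S IH /legal_history_rcons[lh [SU _]]].
  by rewrite /claimed !big_ord0 -setI_eq0 setI0.
have := subset_trans SU (subsetDr _ _); rewrite subsetC subUset.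
rewrite -!disjoints_subset => /andP[dB dM].
rewrite !claimed_rcons; case: (to_move h) => /=.
  by rewrite -setI_eq0 setIUl setU_eq0 !setI_eq0 IH //= disjoint_sym.
by rewrite -setI_eq0 setIUr setU_eq0 !setI_eq0 IH.
Qed.

(** * Positions won by Breaker *)

(** Certificate of a win with Breaker to move, [B] and [M] being the edges claimed so far. It may
    stop as soon as no set avoiding [B] reaches the goal. Maker's replies are only bounded by [a],
    which covers the shorter moves at the end. *)
Inductive breaker_wins_from (T : finType) (board : {set T})
    (goal : {set T} -> Prop) (a b : nat) : {set T} -> {set T} -> Prop :=
| Breaker_has_won (B M : {set T}) of
    (forall M' : {set T}, M' \subset board -> [disjoint M' & B] -> ~ goal M') :
    breaker_wins_from board goal a b B M
| Breaker_plays (B M S : {set T}) of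
    S \subset board :\: (B :|: M) & #|S| = minn b #|board :\: (B :|: M)| &
    (forall S' : {set T}, S' \subset board :\: (B :|: S :|: M) ->
       (#|S'| <= a)%N ->
       breaker_wins_from board goal a b (B :|: S) (M :|: S')) :
    breaker_wins_from board goal a b B M.

(** On a full board all moves are empty, so the certificate descends to its first case without a
    change of position. *)
Lemma breaker_wins_from_end (T : finType) (board : {set T})
    (goal : {set T} -> Prop) (a b : nat) (B M : {set T}) :
  breaker_wins_from board goal a b B M ->
  M \subset board -> [disjoint M & B] -> board :\: (B :|: M) = set0 -> ~ goal M.
Proof.
elim=> {}B {}M => [won|S SU _ _ IH] Mb dMB full; first exact: won.
have S0 : S = set0 by apply/eqP; rewrite -subset0 -full.
by have := IH set0; rewrite S0 !setU0; apply; rewrite ?sub0set ?cards0.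
Qed.

Lemma breaker_wins_from_strategy (T : finType) (board : {set T})
    (goal : {set T} -> Prop) (a b : nat) :
  breaker_wins_from board goal a b set0 set0 ->
  breaker_has_winning_strategy board goal a b.
Proof.
move=> W0; set W := breaker_wins_from board goal a b in W0.
(* On Maker's turn all replies are considered; the empty one serves for histories that end there. *)
pose Inv h := if to_move h then
    forall S' : {set T}, S' \subset unclaimed board h -> (#|S'| <= a)%N ->
      W (claimed Breaker h) (claimed Maker h :|: S')
  else W (claimed Breaker h) (claimed Maker h).
have [|||s [ls sP]] := @strategy_of_invariant T board a b Breaker Inv.
- by rewrite /Inv /= /claimed !big_ord0.
- move=> h lh Ih tm; move: Ih; rewrite /Inv tm /=.
  move eB: (claimed Breaker h) => B; move eM: (claimed Maker h) => M BM.
  case: BM eB eM => {}B {}M => [won|S SU Sb SW] eB eM.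
    have [|//|S [_ lS]] := @exists_legal_move _ board a b h set0;
      rewrite ?sub0set ?cards0 //.
    exists S; split=> //; rewrite to_move_rcons tm /= => S' _ _.
    left=> M' M'b dis; apply: won => //.
    apply: disjointWr dis; rewrite claimed_rcons tm eB; exact: subsetUl.
  exists S; split; first by split; rewrite /unclaimed eB eM // /quota tm.
  rewrite to_move_rcons /unclaimed !claimed_rcons tm /= eB eM => S'.
  exact: SW.
- move=> h lh Ih tm S [SU Sa]; have {}tm : to_move h by case: (to_move h) tm.
  move: Ih; rewrite /Inv to_move_rcons tm /= !claimed_rcons tm /=; apply=> //.
  by rewrite Sa /quota tm geq_minl.
exists s; split=> // h [lh full] /sP - /(_ lh) Ih.
have /breaker_wins_from_end : W (claimed Breaker h) (claimed Maker h).
  move: Ih; rewrite /Inv; case: ifP => // _ /(_ set0).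
  by rewrite setU0; apply; rewrite ?sub0set ?cards0.
apply=> //; [exact: claimed_sub_board lh|exact: claimed_disjoint lh].
Qed.

(** Only inclusions are kept of the next position, so surplus edges of Breaker's move can be
    ignored. *)
Lemma breaker_wins_from_step (T : finType) (board : {set T})
    (goal : {set T} -> Prop) (a b : nat) (B M A : {set T}) :
  A \subset board :\: (B :|: M) -> (#|A| <= b)%N ->
  (forall B' S' : {set T}, B \subset B' -> A \subset B' -> S' \subset board ->
     [disjoint S' & B'] -> (#|S'| <= a)%N ->
     breaker_wins_from board goal a b B' (M :|: S')) ->
  breaker_wins_from board goal a b B M.
Proof.
move=> AU Ab next.
have [|S [AS SU Sb]] := exists_between_card AU
    (q := minn b #|board :\: (B :|: M)|).
  by rewrite leq_min Ab subset_leq_card //= geq_minr.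
right with S => // S' S'U S'a; apply: next => //.
- exact: subsetUl.
- exact: subset_trans AS (subsetUr _ _).
- exact: subset_trans S'U (subsetDl _ _).
have := subset_trans S'U (subsetDr _ _); rewrite disjoints_subset => S'C.
by apply: subset_trans S'C _; rewrite setCS subsetUl.
Qed.

(** * Stars and cliques owned by Breaker *)

Definition star (n : nat) (v : 'I_n) : {set {set 'I_n}} :=
  [set e in complete_graph n | v \in e].

Lemma card_star_le (n : nat) (v : 'I_n) : (#|star v| <= n.-1)%N.
Proof.
have <- : #|[set~ v]| = n.-1 by rewrite cardsC1 card_ord.
apply: leq_trans (leq_imset_card (fun u => [set v; u]) _).
apply/subset_leq_card/subsetP => e; rewrite !inE.
move=> /andP[/cards2P[x [y [xy ->]]]].
rewrite !inE => /orP[] /eqP vE; apply/imsetP.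
  by exists y; rewrite ?inE vE // eq_sym.
by exists x; rewrite ?inE vE // setUC.
Qed.

Lemma star_breaker_wins (n k a b : nat) (B M : {set {set 'I_n}}) (v : 'I_n) :
  (0 < k)%N -> star v \subset B ->
  breaker_wins_from (complete_graph n) (@min_degree_ge n k) a b B M.
Proof.
move=> k0 vB; left=> M' M'b dis /(_ v); rewrite leqNgt => /negP; apply.
apply: leq_trans k0; rewrite ltnS leqn0 cards_eq0; apply/eqP/setP=> e.
rewrite !inE; apply/negP => /andP[eM' ve]; have := disjointFr dis eM'.
by rewrite (subsetP vB) // inE ve (subsetP M'b).
Qed.

(** [cover M] is the set of vertices touched by Maker: no edge of a star centred in [C] is lost
    yet. *)
Definition breaker_clique (n : nat) (B M : {set {set 'I_n}}) (C : {set 'I_n}) :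
    Prop :=
  [disjoint C & cover M] /\
  (forall u v, u \in C -> v \in C -> u != v -> [set u; v] \in B).

Lemma breaker_cliqueW (n : nat) (B M : {set {set 'I_n}}) (C C' : {set 'I_n}) :
  C' \subset C -> breaker_clique B M C -> breaker_clique B M C'.
Proof.
move=> /subsetP sC [dis cl]; split; first exact/(disjointWl _ dis)/subsetP.
by move=> u v /sC uC /sC vC; apply: cl.
Qed.

Lemma leq_card_bigcup (I T : finType) (A : {set I}) (F : I -> {set T}) :
  (#|\bigcup_(i in A) F i| <= \sum_(i in A) #|F i|)%N.
Proof.
elim/big_ind2: _ => [|X x Y y Xx Yy|//]; first by rewrite cards0.
by apply: leq_trans (leq_card_setU x y) _; apply: leq_add.
Qed.

(* Maker's new edges meet a clique owned by Breaker in at most one vertex. *)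
Lemma breaker_clique_reply (n : nat) (B M S : {set {set 'I_n}})
    (C : {set 'I_n}) :
  breaker_clique B M C -> S \subset complete_graph n -> [disjoint S & B] ->
  breaker_clique B (M :|: S) (C :\: cover S) /\
  (#|C| <= #|C :\: cover S| + #|S|)%N.
Proof.
move=> [disC clC] Sb dis; split.
  split; last by move=> u v /setDP[uC _] /setDP[vC _]; apply: clC.
  rewrite /cover bigcup_setU -setI_eq0 setIUr setU_eq0 !setI_eq0.
  rewrite (disjointWl (subsetDl _ _) disC) /= disjoints_subset.
  exact: subsetDr.
rewrite -(cardsID (cover S) C) addnC leq_add2l.
have leS (e : {set 'I_n}) : e \in S -> (#|C :&: e| <= 1)%N.
  move=> eS; rewrite leqNgt; apply/negP.
  move=> /card_gt1P[u [v [/setIP[uC ue] /setIP[vC ve] uv]]].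
  have /negP := disjointFr dis eS; apply.
  have := subsetP Sb e eS; rewrite inE => /eqP e2.
  suff <- : [set u; v] = e by apply: clC.
  by apply/eqP; rewrite eqEcard subUset !sub1set ue ve e2 cards2 uv.
rewrite /cover big_distrr /=.
apply: leq_trans (leq_card_bigcup _ _) _.
by rewrite -sum1_card; apply: leq_sum.
Qed.

Lemma star_free (n : nat) (B M : {set {set 'I_n}}) (v : 'I_n) :
  v \notin cover M -> star v :\: B \subset complete_graph n :\: (B :|: M).
Proof.
move=> vM; apply/subsetP=> e; rewrite !inE => /and3P[eB eb ve].
rewrite eb andbT negb_or eB /=; apply: contra vM => eM.
by apply/bigcupP; exists e.
Qed.

(** * The box game and the building of the clique *)

(** With [1 + i.+1 * a] stars left, Breaker adds up to [q] edges to each, and Maker's reply spoils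
    at most [a] of them; exactly [1 + i * a] survivors are kept. The sum counts what these rounds
    take from a surviving star, and the last [b] edges are claimed in one move. *)
Lemma box_phase (n k a b i : nat) (B M : {set {set 'I_n}}) (C : {set 'I_n}) :
  (0 < k)%N -> breaker_clique B M C -> #|C| = (1 + i * a)%N ->
  (forall v, v \in C ->
     (#|star v :\: B| <= b + \sum_(l < i) b %/ (1 + l.+1 * a))%N) ->
  breaker_wins_from (complete_graph n) (@min_degree_ge n k) a b B M.
Proof.
move=> k0; elim: i B M C => [|i IH] B M C cl cardC leC.
  have /cards1P[v Cv] : #|C| == 1%N by rewrite cardC.
  have vC : v \in C by rewrite Cv set11.
  apply: (@breaker_wins_from_step _ _ _ _ _ _ _ (star v :\: B)).
  - by apply: star_free; case: cl => dis _; rewrite (disjointFr dis vC).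
  - by have := leC v vC; rewrite big_ord0 addn0.
  move=> B' S' BB' AB' _ _ _; apply: (@star_breaker_wins _ _ _ _ _ _ v) => //.
  rewrite -(setID (star v) B) subUset AB' andbT.
  exact: subset_trans (subsetIr _ _) BB'.
set q := (b %/ (1 + i.+1 * a))%N in leC.
have pick (v : 'I_n) : exists A : {set {set 'I_n}},
    A \subset star v :\: B /\ #|A| = minn q #|star v :\: B|.
  have [||A [_ ? ?]] := @exists_between_card _ set0 (star v :\: B)
    (minn q #|star v :\: B|); rewrite ?sub0set ?cards0 ?geq_minr //.
  by exists A.
have [A AP] := boolp.choice pick.
apply: (@breaker_wins_from_step _ _ _ _ _ _ _ (\bigcup_(v in C) A v)).
- apply/bigcupsP => v vC; have [+ _] := AP v => /subset_trans; apply.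
  by apply: star_free; case: cl => dis _; rewrite (disjointFr dis vC).
- apply: leq_trans (leq_card_bigcup _ _) _.
  apply: (@leq_trans (\sum_(v in C) q)%N).
    by apply: leq_sum => v _; have [_ ->] := AP v; apply: geq_minl.
  by rewrite sum_nat_const cardC mulnC leq_trunc_div.
move=> B' S' BB' AB' S'b dis S'a.
have clB' : breaker_clique B' M C.
  by case: cl => ? cl; split=> // u v ? ? ?; apply: (subsetP BB'); apply: cl.
have [cl' cardC'] := breaker_clique_reply clB' S'b dis.
have [||D [_ DC cardD]] := @exists_between_card _ set0 (C :\: cover S')
    (1 + i * a)%N; rewrite ?sub0set ?cards0 //.
  by move: cardC'; rewrite cardC; lia.
apply: (IH B' _ D) => //; first exact: breaker_cliqueW cl'.
move=> v vD; have /setDP[vC _] := subsetP DC _ vD.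
have [Av cAv] := AP v.
have : star v :\: B' \subset (star v :\: B) :\: A v.
  rewrite setDDl; apply: setDS; rewrite subUset BB' /=.
  by apply: subset_trans AB'; apply: bigcup_sup.
move/subset_leq_card; rewrite (cardsD (star v :\: B)) (setIidPr Av) cAv.
have := leC v vC; rewrite big_ord_recr /= -/q; lia.
Qed.

(** [c] is the number of vertices still missing. Breaker joins [a.+1] fresh vertices to [C] and to
    each other; Maker spoils at most [a] vertices, so each round gains one. In at most [N] rounds
    Maker touches at most [2 * (a * N)] vertices, so fresh ones exist. *)
Lemma clique_phase (n k a b N c : nat) (B M : {set {set 'I_n}})
    (C : {set 'I_n}) :
  ((a.+1) * (N + a.+1) <= b)%N -> (N + 2 * (a * N) + a.+1 <= n)%N ->
  (forall (B' M' : {set {set 'I_n}}) (C' : {set 'I_n}),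
     breaker_clique B' M' C' -> #|C'| = N ->
     breaker_wins_from (complete_graph n) (@min_degree_ge n k) a b B' M') ->
  (c <= N)%N -> M \subset complete_graph n -> (#|M| <= a * (N - c))%N ->
  breaker_clique B M C -> #|C| = (N - c)%N ->
  breaker_wins_from (complete_graph n) (@min_degree_ge n k) a b B M.
Proof.
move=> Nb Nn fin; elim: c B M C => [|c IH] B M C cN Mb cardM cl cardC.
  by apply: fin cl _; rewrite cardC subn0.
have coverM : (#|cover M| <= 2 * (a * N))%N.
  apply: leq_trans (leq_card_cover M) _.
  rewrite (eq_bigr (fun=> 2%N)); last first.
    by move=> e /(subsetP Mb); rewrite inE => /eqP.
  rewrite sum_nat_const mulnC leq_mul2l (leq_trans cardM) //.
  by rewrite leq_mul2l leq_subr orbT.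
have [||F [_ FU cardF]] :=
  @exists_between_card _ set0 (~: (C :|: cover M)) a.+1.
- by rewrite sub0set.
- rewrite cards0 /= cardsCs setCK card_ord.
  have := leq_card_setU C (cover M) : (_ <= _)%N.
  by rewrite cardC; move: coverM Nn cN; clear; lia.
have dFC : [disjoint F & C].
  by rewrite disjoints_subset (subset_trans FU) // setCS subsetUl.
have dFM : [disjoint F & cover M].
  by rewrite disjoints_subset (subset_trans FU) // setCS subsetUr.
have [dCM clC] := cl.
pose A := [set [set x; y] | x in F, y in C :|: F & x != y] :\: B.
have AE e : e \in [set [set x; y] | x in F, y in C :|: F & x != y] ->
    e \in complete_graph n /\ e \notin M.
  case/imset2P => x y xF; rewrite inE => /andP[yCF xy] ->.
  rewrite inE cards2 xy; split=> //; apply/negP => xyM.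
  have := disjointFr dFM xF => /negP; apply; apply/bigcupP.
  by exists [set x; y] => //; rewrite !inE eqxx.
apply: (@breaker_wins_from_step _ _ _ _ _ _ _ A).
- apply/subsetP => e /setDP[/AE[eb eM] eB].
  by rewrite in_setD in_setU negb_or eB eM eb.
- apply: leq_trans (subset_leq_card (subsetDl _ _)) _.
  apply: leq_trans (leq_trans (subset_leq_card _) (leq_imset_card
    (fun p => [set p.1; p.2]) (mem (setX F (C :|: F))))) _.
    apply/subsetP => _ /imset2P[x y xF + ->]; rewrite inE => /andP[yCF _].
    by apply/imsetP; exists (x, y); rewrite // in_setX xF.
  have := leq_card_setU C F : (_ <= _)%N.
  rewrite cardsX cardF cardC => cardCF; apply: leq_trans Nb.
  by apply: leq_mul => //; move: cardCF cN; clear; lia.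
move=> B' S BB' AB' Sb dis Sa.
have cl' : breaker_clique B' M (C :|: F).
  have FCF x y : x \in F -> y \in C :|: F -> x != y -> [set x; y] \in B'.
    move=> xF yCF xy; have [xyB|xyB] := boolP ([set x; y] \in B).
      exact: (subsetP BB').
    apply: (subsetP AB'); rewrite inE xyB /=; apply/imset2P.
    by exists x y; rewrite // inE yCF.
  split; first by rewrite -setI_eq0 setIUl setU_eq0 !setI_eq0 dCM.
  move=> x y; rewrite in_setU => /orP[xC|xF yCF xy]; last exact: FCF.
  rewrite in_setU => /orP[yC|yF] xy.
    by apply: (subsetP BB'); apply: clC.
  by rewrite setUC; apply: FCF; rewrite // 1?eq_sym // in_setU xC.
have [cl'' card''] := breaker_clique_reply cl' Sb dis.
(* The clique is trimmed to exactly [N - c] vertices, so that its size also counts the rounds in the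
   bound on [M]. *)
have [||D [_ DC cardD]] := @exists_between_card _ set0 ((C :|: F) :\: cover S)
    (N - c)%N; rewrite ?sub0set ?cards0 //.
  move: card''; rewrite cardsU (disjoint_setI0 _) 1?disjoint_sym // cards0.
  rewrite cardC cardF subn0 /=; clear -cN Sa; move: #|_| #|_| Sa => x y; lia.
apply: (IH B' _ D) => //.
- exact: ltnW.
- by rewrite subUset Mb.
- apply: leq_trans (leq_card_setU M S) _.
  have -> : (N - c = (N - c.+1).+1)%N by clear -cN; lia.
  by rewrite mulnS addnC leq_add.
- exact: breaker_cliqueW cl''.
Qed.

(** The first two bounds allow a clique of [1 + i * a] vertices to be built from the empty one; the
    third lets the box game exhaust the [n - 1] edges of a star. *)
Lemma breaker_criterion (n k a b i : nat) :
  (0 < k)%N ->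
  ((a.+1) * (1 + i * a + a.+1) <= b)%N ->
  (1 + i * a + 2 * (a * (1 + i * a)) + a.+1 <= n)%N ->
  (n <= b.+1 + \sum_(l < i) b %/ (1 + l.+1 * a))%N ->
  breaker_wins_min_degree n k a b.
Proof.
move=> k0 ib iN nb; apply: breaker_wins_from_strategy.
apply: (@clique_phase n k a b (1 + i * a) (1 + i * a) _ _ set0) => //.
- move=> B M C cl cardC; apply: box_phase cl cardC _ => // v vC.
  apply: leq_trans (subset_leq_card (subsetDl _ _)) _.
  apply: leq_trans (card_star_le v) _; lia.
- exact: sub0set.
- by rewrite cards0.
- split; first by rewrite -setI_eq0 set0I.
  by move=> u v; rewrite inE.
- by rewrite cards0 subnn.
Qed.

Lemma breaker_criterion_star (n k a b : nat) :
  (0 < k)%N -> (0 < n)%N -> (n.-1 <= b)%N -> breaker_wins_min_degree n k a b.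
Proof.
move=> k0 n0 nb; apply: breaker_wins_from_strategy.
case: n n0 nb => // n _ nb.
apply: (@breaker_wins_from_step _ _ _ _ _ _ _ (star ord0)).
- by rewrite setU0 setD0; apply/subsetP => e; rewrite inE => /andP[].
- exact: leq_trans (card_star_le _) nb.
by move=> B' S' _ AB' _ _ _; apply: (@star_breaker_wins _ _ _ _ _ _ ord0).
Qed.

(** * Maker's side *)

(** [Inv] concerns positions with Breaker to move only; on Maker's turn it is replaced by the
    existence of a reply restoring it. *)
Lemma maker_wins_of_invariant (T : finType) (board : {set T})
    (goal : {set T} -> Prop) (a b : nat) (Inv : {set T} -> {set T} -> Prop) :
  Inv set0 set0 ->
  (forall B M S : {set T}, Inv B M -> B \subset board ->
     S \subset board :\: (B :|: M) -> (#|S| <= b)%N ->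
     exists S' : {set T},
       [/\ S' \subset board :\: (B :|: S :|: M),
           #|S'| = minn a #|board :\: (B :|: S :|: M)| &
           Inv (B :|: S) (M :|: S')]) ->
  (forall B M : {set T}, Inv B M -> B \subset board ->
     board :\: (B :|: M) = set0 -> goal M) ->
  maker_has_winning_strategy board goal a b.
Proof.
move=> Inv0 step fin.
pose reply B M := exists S' : {set T},
  [/\ S' \subset board :\: (B :|: M), #|S'| = minn a #|board :\: (B :|: M)| &
      Inv B (M :|: S')].
pose I h := if to_move h then reply (claimed Breaker h) (claimed Maker h)
  else Inv (claimed Breaker h) (claimed Maker h).
have [|||s [ls sP]] := @strategy_of_invariant T board a b Maker I.
- by rewrite /I /= /claimed !big_ord0.
- move=> h lh Ih tm; move: Ih; rewrite /I tm => -[S [SU Sa IS]]; exists S.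
  split; first by split; rewrite // /quota tm.
  by rewrite to_move_rcons tm /= !claimed_rcons tm.
- move=> h lh Ih tm S [SU Sb]; have {}tm : to_move h = false.
    by case: (to_move h) tm.
  move: Ih; rewrite /I to_move_rcons tm /= !claimed_rcons tm /= => Ih.
  apply: step => //; first exact: claimed_sub_board lh.
  by rewrite Sb /quota tm geq_minl.
exists s; split=> // h [lh full] /(sP h lh).
have Bb := claimed_sub_board Breaker lh.
rewrite /I; case: ifP => _ => [[S [SU _ IS]]|Ih]; last exact: fin Ih Bb full.
have S0 : S = set0 by apply/eqP; rewrite -subset0 -full.
by apply: fin Bb full; move: IS; rewrite S0 setU0.
Qed.

(** * Degrees, weights and loads of vertex sets *)

Lemma card_star (n : nat) (v : 'I_n) : #|star v| = n.-1.
Proof.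
apply/eqP; rewrite eqn_leq card_star_le /=.
have <- : #|[set~ v]| = n.-1 by rewrite cardsC1 card_ord.
rewrite -(@card_in_imset _ _ (fun u => [set v; u])); last first.
  move=> x y; rewrite !inE => xv yv /setP /(_ x).
  by rewrite !inE eqxx orbT (negPf xv) => /esym/eqP.
apply/subset_leq_card/subsetP => _ /imsetP[u + ->]; rewrite !inE => uv.
by rewrite eqxx cards2 (eq_sym v) uv.
Qed.

Lemma leq_degree (n : nat) (G G' : {set {set 'I_n}}) (v : 'I_n) :
  G \subset G' -> (degree G v <= degree G' v)%N.
Proof.
move=> GG'; apply/subset_leq_card/subsetP => e.
by rewrite !inE => /andP[/(subsetP GG') -> ->].
Qed.

Lemma degreeE (n : nat) (G : {set {set 'I_n}}) (v : 'I_n) :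
  degree G v = (\sum_(e in G) (v \in e))%N.
Proof.
rewrite /degree -sum1_card big_mkcond /= [RHS]big_mkcond.
by apply: eq_bigr => e _; rewrite inE; case: (e \in G); case: (v \in e).
Qed.

Lemma sum_degree (n : nat) (G : {set {set 'I_n}}) (J : {set 'I_n}) :
  (\sum_(v in J) degree G v = \sum_(e in G) #|e :&: J|)%N.
Proof.
under eq_bigr => v _ do rewrite degreeE.
rewrite exchange_big; apply: eq_bigr => e _ /=.
rewrite -sum1_card big_mkcond /= [RHS]big_mkcond; apply: eq_bigr => v _.
by rewrite inE; case: (v \in e); case: (v \in J).
Qed.

(* An edge inside J counts once for small J and twice for large J: there are
   few such edges when J is small, while large sets J hardly affect the sum
   defining [slack]. *)
Definition cap (m j : nat) : nat := if (j <= m)%N then 1 else 2.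

(** For [#|J| <= m] this is the number of edges of [B] meeting [J]; for larger [J], as edges have
    two ends, it is the sum of the Breaker degrees over [J]. *)
Definition weight (n m : nat) (B : {set {set 'I_n}}) (J : {set 'I_n}) : nat :=
  \sum_(e in B) minn (cap m #|J|) #|e :&: J|.

Definition danger (R : realFieldType) (D : R) (n : nat)
    (B M : {set {set 'I_n}}) (v : 'I_n) : R :=
  (degree B v)%:R - D * (degree M v)%:R.

Definition load (R : realFieldType) (D : R) (n m : nat)
    (B M : {set {set 'I_n}}) (J : {set 'I_n}) : R :=
  (weight m B J)%:R - D * (\sum_(v in J) degree M v)%:R.

Lemma weight_le_sum_degree (n m : nat) (B : {set {set 'I_n}})
    (J : {set 'I_n}) : (weight m B J <= \sum_(v in J) degree B v)%N.
Proof. by rewrite sum_degree; apply: leq_sum => e _; apply: geq_minr. Qed.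

(** Only edges from [v] into [J] can lose a unit, being counted already, and only if the cap is
    still 1 after [v] is added. Each is determined by its end in [J]. *)
Lemma weight_setU1 (n m : nat) (B : {set {set 'I_n}}) (J : {set 'I_n})
    (v : 'I_n) :
  B \subset complete_graph n -> v \notin J ->
  (weight m B J + degree B v <= weight m B (v |: J) + (#|J| < m) * #|J|)%N.
Proof.
move=> Bb vJ.
have inner : (\sum_(e in B) ((v \in e) && (e :&: J != set0) : nat) <= #|J|)%N.
  rewrite -big_mkcondr sum1_card.
  apply: leq_trans (leq_imset_card (fun u => [set v; u]) (mem J)).
  apply/subset_leq_card/subsetP => e; rewrite unfold_in.
  case/and3P => eB ve /set0Pn[u /setIP[ue uJ]]; apply/imsetP; exists u => //.
  have := subsetP Bb e eB; rewrite inE => /eqP e2; apply/esym/eqP.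
  rewrite eqEcard subUset !sub1set ve ue e2 cards2.
  by rewrite (contraNneq _ vJ) // => ->.
apply: (@leq_trans (weight m B (v |: J) +
  (#|J| < m) *
    \sum_(e in B) ((v \in e) && (e :&: J != set0) : nat))%N); last first.
  by rewrite leq_add2l leq_mul2l inner orbT.
rewrite /weight degreeE big_distrr -!big_split /=.
apply: leq_sum => e eB.
have eJ : #|e :&: (v |: J)| = ((v \in e) + #|e :&: J|)%N.
  rewrite setIUr cardsU.
  have -> : (e :&: [set v]) :&: (e :&: J) = set0.
    apply/setP => x; rewrite !inE; case: eqP => [->|]; last by rewrite !andbF.
    by rewrite (negPf vJ) !andbF.
  rewrite cards0 subn0; congr addn; case: (boolP (v \in e)) => ve.
    by rewrite (setIidPr _) ?sub1set ?cards1.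
  by apply/eqP; rewrite cards_eq0 setI_eq0 disjoint_sym disjoints1.
have : (#|e :&: (v |: J)| <= 2)%N.
  have := subsetP Bb e eB; rewrite inE => /eqP <-.
  exact: subset_leq_card (subsetIl _ _).
rewrite eJ cardsU1 vJ add1n -cards_eq0 /cap; clear.
move: #|e :&: J| #|J| => x j.
by case: (v \in e); case: (leqP j m) => jm; case: (leqP j.+1 m) => jm';
   case: (posnP x) => x0 /=; rewrite ?eqn0Ngt ?x0 /=; lia.
Qed.

(** As [v] is at least as dangerous as all of [J], adding it lowers the average only through the at
    most [#|J|] units lost in [weight_setU1]. Divided by [#|J| + 1] this is less than 1, and occurs
    only for [#|J| < m], when [m - #|J|] drops by 1. *)
Lemma load_setU1 (R : realFieldType) (D : R) (n m : nat)
    (B M : {set {set 'I_n}}) (J : {set 'I_n}) (v : 'I_n) :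
  B \subset complete_graph n -> J != set0 -> v \notin J ->
  (forall u, u \in J -> danger D B M u <= danger D B M v) ->
  load D m B M J / #|J|%:R - (m - #|J|)%:R <=
  load D m B M (v |: J) / #|v |: J|%:R - (m - #|v |: J|)%:R.
Proof.
move=> Bb J0 vJ vmax.
have avg : load D m B M J <= #|J|%:R * danger D B M v.
  have : \sum_(u in J) danger D B M u <= #|J|%:R * danger D B M v.
    rewrite mulr_natl -sumr_const; exact: ler_sum.
  apply: le_trans; rewrite sumrB -mulr_sumr -!natr_sum lerB // ler_nat.
  exact: weight_le_sum_degree.
have grow : load D m B M J + danger D B M v <=
    load D m B M (v |: J) + ((#|J| < m) * #|J|)%:R.
  have := weight_setU1 m Bb vJ; rewrite -(ler_nat R) !natrD => wle.
  rewrite /load /danger big_setU1 //= natrD mulrDr.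
  move: wle; set x := (_ * _)%:R; lra.
have j0 : (0 < #|J|)%N by rewrite card_gt0.
rewrite cardsU1 vJ /=.
have -> : (m - #|J|)%:R = (m - (1 + #|J|))%:R + (#|J| < m)%:R :> R.
  by rewrite -natrD; congr _%:R; case: ltnP; lia.
move: avg grow; set L := load D m B M J; set L' := load D m B M (v |: J).
set x := danger D B M v; rewrite natrM natrD.
set d := (#|J| < m)%:R; have d0 : 0 <= d by rewrite ler0n.
set j := #|J|%:R; have {}j0 : 0 < j by rewrite ltr0n.
move=> avg grow; suff : L / j <= L' / (1 + j) + d by lra.
have j1 : 0 < 1 + j by lra.
have L'E : L' = L' / (1 + j) * (1 + j) by rewrite divfK // gt_eqF.
rewrite ler_pdivrMr // -(ler_pM2r j1); set q := L' / (1 + j) in L'E *.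
have grow' : j * (L + x) <= j * (L' + d * j) by rewrite ler_pM2l.
have dj : 0 <= d * j by rewrite mulr_ge0 // ltW.
rewrite L'E in grow'; lra.
Qed.

(** * The bound on the average danger *)

(* Solves [slack j = slack j.+1 + cap m j.+1 * b / (a * j.+1)], with a jump at
   [j = m] which absorbs that of [cap m]. *)
Definition slack (R : realFieldType) (a b n m j : nat) : R :=
  \sum_(j.+1 <= i < n.+1) (cap m i)%:R * b%:R / (a%:R * i%:R) +
  (j <= m)%:R * (b%:R / m.+1%:R).

Lemma slackS (R : realFieldType) (a b n m j : nat) : (j < n)%N ->
  slack R a b n m j = slack R a b n m j.+1 +
    (cap m j.+1)%:R * b%:R / (a%:R * j.+1%:R) + (j == m)%:R * (b%:R / m.+1%:R).
Proof.
move=> jn; rewrite /slack big_ltn // leq_eqVlt.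
by case: (ltngtP j m) => _ /=; ring.
Qed.

(** A share [1 / a] of the term at [j.+1] is the increment of [slack]. The share [t - 1 / a] that
    remains only grows from [j.+1] to [j], except at [j = m], where [cap] falls from 2 to 1; the
    jump of [slack] makes up for this because the share is at most 1. *)
Lemma slack_step (R : realFieldType) (a b n m j : nat) (t : R) :
  (0 < a)%N -> a%:R^-1 <= t -> t <= 1 -> (j < n)%N -> (0 < j)%N ->
  slack R a b n m j.+1 + t * ((cap m j.+1)%:R * b%:R / j.+1%:R) <=
  slack R a b n m j + (t - a%:R^-1) * ((cap m j)%:R * b%:R / j%:R).
Proof.
move=> a0 ta t1 jn j0; rewrite (slackS _ _ _ _ jn).
have a0R : 0 < a%:R :> R by rewrite ltr0n.
have -> : (cap m j.+1)%:R * b%:R / (a%:R * j.+1%:R) =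
    a%:R^-1 * ((cap m j.+1)%:R * b%:R / j.+1%:R) :> R.
  by rewrite invfM mulrCA mulrA.
set s := t - a%:R^-1.
have s0 : 0 <= s by rewrite subr_ge0.
have s1 : s <= 1 by rewrite lerBlDr (le_trans t1) // lerDl invr_ge0 ltW.
suff : s * ((cap m j.+1)%:R * b%:R / j.+1%:R) <=
    (j == m)%:R * (b%:R / m.+1%:R) + s * ((cap m j)%:R * b%:R / j%:R).
  rewrite /s !mulrBl; set x := _ / j.+1%:R; set y := _ / j%:R.
  set z := _ * (_ / m.+1%:R); lra.
have w0 : 0 <= b%:R / j.+1%:R :> R by rewrite divr_ge0.
have wu : b%:R / j.+1%:R <= b%:R / j%:R :> R.
  by rewrite ler_wpM2l // lef_pV2 ?posrE ?ltr0n // ler_nat.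
rewrite -!(mulrA _%:R b%:R); have swu := ler_wpM2l s0 wu.
case: (eqVneq j m) swu w0 => [->|jm] swu w0; rewrite /cap.
  rewrite leqnn ltnn mul1r; have := ler_piMl w0 s1; move: swu.
  set u := b%:R / m%:R; set w := b%:R / m.+1%:R; lra.
have -> : (j.+1 <= m)%N = (j <= m)%N by rewrite [RHS]leq_eqVlt (negPf jm).
rewrite mul0r add0r; case: ifP => _; first by rewrite !mul1r.
rewrite ![s * (2 * _)]mulrCA; exact: ler_wpM2l swu.
Qed.

(** * Maker's invariant through one round *)

(* [t] is the fraction of Maker's turn that remains to be played. *)
Definition balanced (R : realFieldType) (n k a b m : nat) (t : R)
    (B M : {set {set 'I_n}}) : Prop :=
  forall J : {set 'I_n}, J != set0 ->
    (forall v, v \in J -> (degree M v < k)%N) ->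
    load (2 * b%:R / a%:R) m B M J / #|J|%:R - (m - #|J|)%:R <=
    slack R a b n m #|J| + t * ((cap m #|J|)%:R * b%:R / #|J|%:R).

(** The first four terms bound Breaker's degree at a vertex of Maker-degree less than [k]; adding
    [k] Maker edges does not exhaust its star. *)
Definition maker_condition (R : realFieldType) (n k a b m : nat) : Prop :=
  slack R a b n m 1 + m%:R + b%:R + (2 * b%:R / a%:R) * k%:R + k%:R <= n%:R - 1.

Lemma weight_set1 (n m : nat) (B : {set {set 'I_n}}) (v : 'I_n) :
  weight m B [set v] = degree B v.
Proof.
rewrite degreeE; apply: eq_bigr => e _; rewrite cards1.
have -> : #|e :&: [set v]| = (v \in e) :> nat.
  case: (boolP (v \in e)) => ve; first by rewrite (setIidPr _) ?sub1set ?cards1.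
  by apply/eqP; rewrite cards_eq0 setI_eq0 disjoint_sym disjoints1.
by rewrite /cap; case: ifP; case: (v \in e).
Qed.

(** The invariant for the singleton [[set v]] bounds Breaker's degree at [v]. *)
Lemma balanced_active (R : realFieldType) (n k a b m : nat) (t : R)
    (B M : {set {set 'I_n}}) (v : 'I_n) :
  maker_condition R n k a b m -> (0 < a)%N -> (0 < m)%N -> t <= 1 ->
  balanced k a b m t B M -> (degree M v < k)%N ->
  exists2 e, e \in complete_graph n :\: (B :|: M) & v \in e.
Proof.
move=> cond a0 m0 t1 bal vk.
set D := 2 * b%:R / a%:R : R.
have D0 : 0 <= D by rewrite divr_ge0 // mulr_ge0.
have dB : (degree B v)%:R <= slack R a b n m 1 + m%:R - 1 + b%:R +
    D * (degree M v)%:R.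
  have := bal [set v]; rewrite /load weight_set1 big_set1 -card_gt0 cards1.
  rewrite /cap m0 !divr1 natrB // -/D => /(_ isT) H.
  have {H} := H (fun u => ltac:(by rewrite inE => /eqP ->)).
  have : t * (1%:R * b%:R) <= b%:R :> R by rewrite mul1r ler_piMl.
  lra.
have [full|[e]] := set_0Vmem (star v :\: (B :|: M)); last first.
  case/setDP; rewrite [e \in star v]inE => /andP[eb ve] eBM.
  by exists e; rewrite // in_setD eBM.
have : (n.-1 <= degree B v + degree M v)%N.
  rewrite -(card_star v) /degree; apply: leq_trans (leq_card_setU _ _).
  apply/subset_leq_card/subsetP => e ve; have /setP/(_ e) := full.
  by move: ve; rewrite !inE => /andP[-> ->]; rewrite !andbT => /negbFE.
have n0 : (0 < n)%N := leq_ltn_trans (leq0n v) (ltn_ord v).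
rewrite -(ler_nat R) natrD -subn1 natrB // => ndeg.
have Mk : (degree M v)%:R + 1 <= k%:R :> R by rewrite natr1 ler_nat.
have DMk : D * (degree M v)%:R <= D * k%:R by rewrite ler_wpM2l // ler_nat ltnW.
by move: cond; rewrite /maker_condition -/D; lra.
Qed.

(** One edge adds at most [cap] to the weight, so [b] edges raise the average by at most the term
    that [t = 1] allows. *)
Lemma balanced_breaker (R : realFieldType) (n k a b m : nat)
    (B M S : {set {set 'I_n}}) :
  (#|S| <= b)%N -> balanced k a b m (0 : R) B M ->
  balanced k a b m (1 : R) (B :|: S) M.
Proof.
move=> Sb bal J J0 Jk; have := bal J J0 Jk; rewrite mul0r mul1r addr0.
have : (weight m (B :|: S) J <= weight m B J + cap m #|J| * b)%N.
  apply: (@leq_trans (weight m B J +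
      \sum_(e in S) minn (cap m #|J|) #|e :&: J|)).
    rewrite /weight big_mkcond [X in (_ <= X + _)%N]big_mkcond.
    rewrite [X in (_ <= _ + X)%N]big_mkcond -big_split /=.
    apply: leq_sum => e _; rewrite in_setU.
    by case: (e \in B); case: (e \in S); rewrite /= ?addn0 ?leq_addr.
  rewrite leq_add2l mulnC; apply: leq_trans (leq_mul Sb (leqnn _)).
  by rewrite -sum_nat_const; apply: leq_sum => e _; apply: geq_minl.
rewrite -(ler_nat R) natrD natrM /load => wle.
have j0 : 0 < #|J|%:R :> R by rewrite ltr0n card_gt0.
set j := #|J|%:R in j0 *; set y := (\sum_(v in J) _)%:R; move=> balJ.
set c := _ * _ in wle *; set x := (weight _ B J)%:R in wle balJ.
have : ((weight m (B :|: S) J)%:R - 2 * b%:R / a%:R * y) / j <=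
    (x - 2 * b%:R / a%:R * y) / j + c / j.
  by rewrite -mulrDl ler_pM2r ?invr_gt0 //; lra.
lra.
Qed.

(** Maker plays at a most dangerous vertex [v] of degree below [k]. If [v] is in [J], the average
    drops by [D / #|J|]; otherwise the old invariant for [v |: J] is carried to [J] by [load_setU1]
    and [slack_step]. *)
Lemma balanced_maker (R : realFieldType) (n k a b m : nat) (t : R)
    (B M : {set {set 'I_n}}) :
  maker_condition R n k a b m -> (0 < a)%N -> (0 < m)%N ->
  a%:R^-1 <= t <= 1 -> B \subset complete_graph n ->
  balanced k a b m t B M -> complete_graph n :\: (B :|: M) != set0 ->
  exists2 e, e \in complete_graph n :\: (B :|: M) &
    balanced k a b m (t - a%:R^-1) B (e |: M).
Proof.
move=> cond a0 m0 /andP[ta t1] Bb bal /set0Pn[e0 e0U].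
(* Once all degrees reach [k] the invariant is vacuous and any free edge will do. *)
have [/existsP[v0 v0k]|/existsPn noact] :=
  boolP [exists v : 'I_n, (degree M v < k)%N]; last first.
  exists e0 => // J /set0Pn[v vJ] /(_ v vJ); rewrite ltnNge => /negP[].
  have := noact v; rewrite -leqNgt => /leq_trans; apply.
  exact/leq_degree/subsetUr.
set D := 2 * b%:R / a%:R : R.
case: (@arg_maxP _ _ _ v0 [pred v | (degree M v < k)%N] (danger D B M) v0k).
move=> v /= vk vmax.
have [e eU ve] := balanced_active cond a0 m0 t1 bal vk.
exists e => // J J0 Jk.
have MeM : M \subset e |: M by apply: subsetUr.
have kW u : u \in J -> (degree M u < k)%N.
  by move=> /Jk; apply: leq_ltn_trans; apply: leq_degree.
have degle : (\sum_(u in J) degree M u <= \sum_(u in J) degree (e |: M) u)%N.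
  by apply: leq_sum => u _; apply: leq_degree.
have a0R : 0 < a%:R :> R by rewrite ltr0n.
have j0 : 0 < #|J|%:R :> R by rewrite ltr0n card_gt0.
have D0 : 0 <= D by rewrite divr_ge0 // mulr_ge0.
have cap2 : (cap m #|J|)%:R <= 2 :> R by rewrite ler_nat /cap; case: ifP.
have [vJ|vJ] := boolP (v \in J).
  have := bal J J0 kW.
  have : load D m B (e |: M) J <= load D m B M J - D.
    have : (\sum_(u in J) degree M u + 1 <= \sum_(u in J) degree (e |: M) u)%N.
      rewrite (bigD1 v) //= [X in (_ <= X)%N](bigD1 v) //= addnAC.
      apply: leq_add; last by apply: leq_sum => u _; apply: leq_degree.
      rewrite addn1; apply: proper_card; apply/properP.
      split.
        by apply/subsetP => f; rewrite !inE => /andP[-> ->]; rewrite orbT.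
      exists e; rewrite !inE ?eqxx ?ve // negb_and.
      by move: eU; rewrite !inE negb_or -andbA => /and3P[_ -> _].
    rewrite -(ler_nat R) natrD /load => /(ler_wpM2l D0); lra.
  rewrite -/D => loadle balJ.
  have : load D m B (e |: M) J / #|J|%:R <= (load D m B M J - D) / #|J|%:R.
    by rewrite ler_pM2r ?invr_gt0.
  (* The factor 2 in [D] is there because [cap] may be 2. *)
  have : a%:R^-1 * ((cap m #|J|)%:R * b%:R / #|J|%:R) <= D / #|J|%:R.
    rewrite mulrA ler_pM2r ?invr_gt0 // mulrC ler_pM2r ?invr_gt0 //.
    by rewrite ler_wpM2r.
  have -> : (load D m B M J - D) / #|J|%:R =
      load D m B M J / #|J|%:R - D / #|J|%:R by rewrite mulrBl.
  move: balJ; rewrite [(t - _) * _]mulrBl; set x := _ * _ / _; set y := D / _.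
  set z := load D m B M J / _; set w := load D m B _ J / _.
  lra.
have := bal (v |: J).
have : load D m B (e |: M) J <= load D m B M J.
  by rewrite /load lerB // ler_wpM2l // ler_nat.
have := @load_setU1 _ D _ m B M _ _ Bb J0 vJ (fun u uJ => vmax u (kW u uJ)).
rewrite -/D cardsU1 vJ /= add1n => grow loadle bal'.
have jn : (#|J| < n)%N.
  have : (#|v |: J| <= n)%N by rewrite -[X in (_ <= X)%N]card_ord max_card.
  by rewrite cardsU1 vJ.
have {}bal' : load D m B M (v |: J) / #|J|.+1%:R - (m - #|J|.+1)%:R <=
    slack R a b n m #|J|.+1 + t * ((cap m #|J|.+1)%:R * b%:R / #|J|.+1%:R).
  apply: bal' => [|u]; first by rewrite -card_gt0 cardsU1 vJ.
  by rewrite !inE => /orP[/eqP->|/kW].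
have := ler_wpM2r (ltW (_ : 0 < #|J|%:R^-1)) loadle.
rewrite invr_gt0 => /(_ j0) {}loadle.
have jgt0 : (0 < #|J|)%N by rewrite card_gt0.
have := @slack_step R a b n m _ t a0 ta t1 jn jgt0.
set x := t * _ in bal' *; set y := (t - _) * _.
set z := _ / #|J|.+1%:R in grow bal'; set w := _ / _ in grow loadle.
set w' := _ / _ in loadle *; lra.
Qed.

(** The turn is played edge by edge, with [t = 1 - i / a] after [i] edges. *)
Lemma maker_criterion (R : realFieldType) (n k a b m : nat) :
  maker_condition R n k a b m -> (0 < a)%N -> (0 < m)%N ->
  maker_wins_min_degree n k a b.
Proof.
move=> cond a0 m0.
apply: (@maker_wins_of_invariant _ _ _ a b (balanced k a b m (0 : R))).
- move=> J J0 _; rewrite /load /weight big_set0 mul0r addr0.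
  rewrite big1 => [|v _]; last by rewrite degreeE big_set0.
  rewrite mulr0 subr0 mul0r sub0r; apply: (@le_trans _ _ 0).
    by rewrite oppr_le0.
  rewrite addr_ge0 ?mulr_ge0 ?divr_ge0 //; apply: sumr_ge0 => i _.
  by rewrite divr_ge0 // mulr_ge0.
- move=> B M S bal Bb SU Sb; have bal1 := balanced_breaker Sb bal.
  set B' := B :|: S in bal1 *.
  have B'b : B' \subset complete_graph n.
    by rewrite subUset Bb (subset_trans SU) // subsetDl.
  suff turn i : (i <= a)%N -> exists S' : {set {set 'I_n}},
      [/\ S' \subset complete_graph n :\: (B' :|: M),
          #|S'| = minn i #|complete_graph n :\: (B' :|: M)| &
          balanced k a b m (1 - i%:R / a%:R : R) B' (M :|: S')].
    have [S' [? ? balS']] := turn a (leqnn a); exists S'; split=> //.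
    by move: balS'; rewrite divff ?subrr // pnatr_eq0 -lt0n.
  elim: i => [|i IH] ia.
    by exists set0; rewrite sub0set cards0 min0n mul0r subr0 setU0.
  have [S' [S'U S'i balS']] := IH (ltnW ia).
  have dec : complete_graph n :\: (B' :|: (M :|: S')) =
      (complete_graph n :\: (B' :|: M)) :\: S' by rewrite setUA setDDl.
  (* If the board runs out during the turn, no vertex of degree below [k] is left, since it would
     have a free edge; the invariant is then vacuous. *)
  have [full|nfull] := eqVneq (complete_graph n :\: (B' :|: (M :|: S'))) set0.
    exists S'; split; rewrite ?S'U //.
      have S'E : S' = complete_graph n :\: (B' :|: M).
        by apply/eqP; rewrite eqEsubset S'U -setD_eq0 -dec full eqxx.
      move: S'i; rewrite -S'E => S'i; apply/esym/minn_idPr; rewrite S'i.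
      by rewrite (leq_trans (geq_minl _ _)).
    move=> J /set0Pn[v vJ] /(_ v vJ) vk.
    have t1 : 1 - i%:R / a%:R <= 1 :> R by rewrite gerBl divr_ge0.
    have [e] := balanced_active cond a0 m0 t1 balS' vk.
    by rewrite full inE.
  have [|e] := balanced_maker cond a0 m0 _ B'b balS' nfull.
    rewrite gerBl divr_ge0 // andbT lerBrDr -{1}[a%:R^-1]mul1r.
    by rewrite -mulrDl ler_pdivrMr ?ltr0n // mul1r addrC natr1 ler_nat.
  rewrite dec => /setDP[eU eS'] bale; exists (e |: S').
  rewrite subUset sub1set eU S'U setUCA; split=> //.
    rewrite cardsU1 eS' S'i add1n.
    have : (#|S'| < #|complete_graph n :\: (B' :|: M)|)%N.
      apply: proper_card; apply/properP; split=> //; by exists e.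
    by rewrite S'i gtn_min ltnn orbF => lti; rewrite !(minn_idPl _) // ltnW.
  have <- : 1 - i%:R / a%:R - a%:R^-1 = 1 - i.+1%:R / a%:R :> R; last by [].
  by rewrite -natr1; field; rewrite pnatr_eq0 -lt0n.
- move=> B M bal Bb full v; rewrite leqNgt; apply/negP => vk.
  have [e] := balanced_active cond a0 m0 ler01 bal vk.
  by rewrite full inE.
Qed.

(** * Asymptotics *)

Lemma harmonic_le_ln (R : realType) (n : nat) : (0 < n)%N ->
  \sum_(2 <= i < n.+1) i%:R^-1 <= ln n%:R :> R.
Proof.
elim: n => // -[_ _|n IH _]; first by rewrite big_geq // ln1.
rewrite big_nat_recr //=; apply: le_trans (lerD (IH isT) (lexx _)) _.
have n1 : 0 < n.+1%:R :> R by rewrite ltr0n.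
have n2 : 0 < n.+2%:R :> R by rewrite ltr0n.
suff : ln (n.+1%:R / n.+2%:R) <= - n.+2%:R^-1 :> R.
  by rewrite ln_div ?posrE //; set x := _^-1; lra.
have -> : n.+1%:R / n.+2%:R = 1 + - n.+2%:R^-1 :> R.
  by rewrite -[n.+1%:R](addrK 1) natr1 mulrBl divff ?gt_eqF // mul1r.
by apply: le_ln1Dx; rewrite ltrN2 invf_lt1 // ltr1n.
Qed.

(** The first unit of [cap] gives the harmonic sum; the second occurs for [i > m] only, where
    [1 / i] is at most [1 / (m + 1)]. *)
Lemma slack1_le (R : realType) (a b n m : nat) : (0 < n)%N -> (0 < a)%N ->
  slack R a b n m 1 <=
  b%:R / a%:R * (ln n%:R + n%:R / m.+1%:R) + b%:R / m.+1%:R.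
Proof.
move=> n0 a0; rewrite /slack lerD //; last first.
  by case: (1 <= m)%N; rewrite ?mul1r // mul0r divr_ge0.
have -> : \sum_(2 <= i < n.+1) (cap m i)%:R * b%:R / (a%:R * i%:R) =
    b%:R / a%:R * \sum_(2 <= i < n.+1) (cap m i)%:R / i%:R :> R.
  by rewrite big_distrr; apply: eq_bigr => i _ /=; rewrite invfM; ring.
rewrite ler_wpM2l ?divr_ge0 //.
apply: (@le_trans _ _ (\sum_(2 <= i < n.+1) (i%:R^-1 + m.+1%:R^-1))).
  rewrite !big_nat; apply: ler_sum => i /andP[i2 _].
  rewrite /cap; case: leqP => im; first by rewrite mul1r lerDl invr_ge0.
  rewrite (_ : 2 = 1 + 1) // mulrDl mul1r lerD2l.
  by rewrite lef_pV2 ?posrE ?ltr0n ?ler_nat // ltnW.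
rewrite big_split /= lerD ?harmonic_le_ln // sumr_const_nat -[_ *+ _]mulr_natl.
by rewrite ler_wpM2r ?invr_ge0 // ler_nat subSS leq_subr.
Qed.

Lemma maker_criterion_ln (R : realType) (n k a b : nat) (d : R) :
  (0 < n)%N -> (0 < a)%N -> 0 < d -> 1 <= d * n%:R ->
  b%:R / a%:R * (a%:R + ln n%:R + d^-1 + 2 * k%:R) +
    d^-1 + d * n%:R + k%:R + 1 <= n%:R ->
  maker_wins_min_degree n k a b.
Proof.
move=> n0 a0 d0 dn H.
have dn0 : 0 <= d * n%:R by rewrite mulr_ge0 // ltW.
(* [m] is the integer part of [d * n], so [n / (m + 1)] is at most [1 / d]. *)
have /andP[mle mlt] := truncn_itv dn0; set m := Num.truncn _ in mle mlt.
have m0 : (0 < m)%N.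
  by rewrite -ltnS -(ltr_nat R) (le_lt_trans dn).
have a0R : 0 < a%:R :> R by rewrite ltr0n.
have nm : n%:R / m.+1%:R <= d^-1 :> R.
  by rewrite ler_pdivrMr ?ltr0n // ler_pdivlMl // ltW.
have x0 : 0 <= b%:R / a%:R :> R by rewrite divr_ge0.
have L0 : 0 <= ln n%:R :> R by rewrite ln_ge0 // ler1n.
have dV0 : 0 < d^-1 by rewrite invr_gt0.
have xa : b%:R / a%:R * a%:R = b%:R :> R by rewrite divfK // gt_eqF.
(* [H] implies [b <= n], through its term [b / a * a]. *)
have bm : b%:R / m.+1%:R <= d^-1.
  apply: le_trans nm; rewrite ler_wpM2r ?invr_ge0 // -xa.
  apply: le_trans H; set x := _ / _ in x0 *.
  have : 0 <= x * (ln n%:R + d^-1 + 2 * k%:R).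
    by rewrite mulr_ge0 // !addr_ge0 ?mulr_ge0 // ltW.
  have : 0 <= k%:R :> R by [].
  lra.
apply: (@maker_criterion R _ _ _ _ m) => //; rewrite /maker_condition.
have := slack1_le R b m n0 a0.
have : b%:R / a%:R * (ln n%:R + n%:R / m.+1%:R) <=
    b%:R / a%:R * (ln n%:R + d^-1) by rewrite ler_wpM2l // lerD2l.
have -> : 2 * b%:R / a%:R = 2 * (b%:R / a%:R) :> R by rewrite mulrA.
set s := slack _ _ _ _ _ _; set x := b%:R / a%:R in xa H *.
set y := _ / m.+1%:R in bm *; set z := n%:R / _; lra.
Qed.

(** [s] stands for the dominant part of [a + ln n]. With [d = eps / 4], the product
    [(1 + eps / 4) * (1 - eps)] is below [1 - 3 * eps / 4], which leaves room for [d * n] and for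
    [eps / 4 * n] of lower-order terms. *)
Lemma maker_asymptotic (R : realType) (n k a b : nat) (eps s : R) :
  (0 < n)%N -> (0 < a)%N -> 0 < eps -> eps <= 1 ->
  a%:R + ln n%:R + 4 / eps + 2 * k%:R <= (1 + eps / 4) * s ->
  b%:R / a%:R * s <= (1 - eps) * n%:R ->
  k%:R + 1 + 4 / eps <= eps / 4 * n%:R ->
  maker_wins_min_degree n k a b.
Proof.
move=> n0 a0 e0 e1 Hs Hb Hk.
have dE : (eps / 4)^-1 = 4 / eps by rewrite invf_div.
have V0 : 0 < 4 / eps by rewrite divr_gt0.
have k0 : 0 <= k%:R :> R by [].
have nR : 0 <= n%:R :> R by [].
apply: (@maker_criterion_ln R _ _ _ _ (eps / 4)) => //.
- by rewrite divr_gt0.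
- by apply: le_trans Hk; lra.
rewrite dE.
have x0 : 0 <= b%:R / a%:R :> R by rewrite divr_ge0.
have := ler_wpM2l x0 Hs.
have : (1 + eps / 4) * (b%:R / a%:R * s) <= (1 + eps / 4) * ((1 - eps) * n%:R).
  by rewrite ler_wpM2l //; lra.
have : 0 <= eps * n%:R * eps by rewrite !mulr_ge0 // ltW.
set x := b%:R / a%:R; set w := 4 / eps in Hk *; nra.
Qed.

(** * Estimates for Breaker *)

(** For [p = 1 + l.+1 * a], [b / p] is at least [b / a] times [ln ((p + a) / p)], and these
    logarithms telescope from [a.+1] on. Each floor loses at most 1, hence the [i]. *)
Lemma sum_divn_ge_ln (R : realType) (a b i : nat) : (0 < a)%N ->
  b%:R / a%:R * (ln i.+1%:R - ln a.+1%:R) - i%:R <=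
  (\sum_(l < i) b %/ (1 + l.+1 * a))%:R :> R.
Proof.
move=> a0; have a0R : 0 < a%:R :> R by rewrite ltr0n.
have x0 : 0 <= b%:R / a%:R :> R by rewrite divr_ge0.
apply: (@le_trans _ _
    (b%:R / a%:R * (ln (1 + i.+1 * a)%:R - ln a.+1%:R) - i%:R)).
  rewrite lerD2r ler_wpM2l // lerD2r ler_ln ?posrE ?ltr0n // ler_nat.
  exact: leqW (leq_pmulr _ a0).
elim: i => [|i IH].
  by rewrite big_ord0 mul1n add1n subrr mulr0 subr0.
rewrite big_ord_recr /= [leRHS]natrD.
apply: le_trans (lerD IH (lexx _)).
set p := (1 + i.+1 * a)%N; have p0 : 0 < p%:R :> R by rewrite ltr0n.
have -> : (1 + i.+2 * a)%:R = p%:R * (1 + a%:R / p%:R) :> R.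
  rewrite mulrDr mulr1 mulrCA divff ?gt_eqF // mulr1 -natrD /p.
  by congr _%:R; lia.
have ap : 0 < a%:R / p%:R :> R by rewrite divr_gt0.
rewrite lnM ?posrE ?addr_gt0 //.
have lnle : ln (1 + a%:R / p%:R) <= a%:R / p%:R :> R.
  by apply: le_ln1Dx; lra.
have := ler_wpM2l x0 lnle.
have -> : b%:R / a%:R * (a%:R / p%:R) = b%:R / p%:R :> R.
  by rewrite mulrA divfK // gt_eqF.
have : b%:R / p%:R <= (b %/ p)%:R + 1 :> R.
  by rewrite ler_pdivrMr // natr1 -natrM ler_nat ltnW // ltn_ceil.
rewrite -(natr1 i); set x := b%:R / a%:R; set y := b%:R / p%:R; lra.
Qed.

(** If [ln n <= eps * a], the bias is at least [n] and one star suffices. Otherwise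
    [a < ln n / eps], and [i] is about [n ^ (1 - eps / 8)]; by the exponential hypothesis
    [n ^ (eps / 8)] outweighs the powers of [a] and [ln n] that occur. *)
Lemma breaker_asymptotic (R : realType) (n k a b : nat) (eps : R) :
  (0 < k)%N -> (0 < n)%N -> (0 < a)%N -> 0 < eps -> eps <= 1 ->
  8 / eps ^+ 2 * (1 + ln n%:R) ^+ 3 <= expR (eps / 8 * ln n%:R) ->
  (1 + eps) * (a%:R * n%:R / (a%:R + ln n%:R)) <= b%:R ->
  breaker_wins_min_degree n k a b.
Proof.
move=> k0 n0 a0 e0 e1 Hexp Hb.
have a1R : 1 <= a%:R :> R by rewrite ler1n.
have nR : 0 < n%:R :> R by rewrite ltr0n.
set L := ln n%:R in Hexp Hb; have L0 : 0 <= L by rewrite ln_ge0 // ler1n.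
have aL0 : 0 < a%:R + L by lra.
set q := n%:R / (a%:R + L) : R; have q0 : 0 < q by rewrite divr_gt0.
have qE : q * (a%:R + L) = n%:R by rewrite divfK // gt_eqF.
rewrite -mulrA -/q in Hb.
have [La|aL] := leP L (eps * a%:R).
  apply: breaker_criterion_star => //; apply: leq_trans (leq_pred n) _.
  rewrite -(ler_nat R); apply: le_trans Hb; rewrite -qE; nra.
set d := eps / 8 in Hexp.
have nE : n%:R = expR L by rewrite lnK // posrE.
set T := expR (d * L) in Hexp.
set N := expR ((1 - d) * L).
have NT : N * T = n%:R by rewrite nE -expRD; congr expR; ring.
have d0 : 0 < d by rewrite divr_gt0.
have T0 : 0 < T by exact: expR_gt0.
have N1 : 1 <= N.
  by rewrite -expR0 ler_expR mulr_ge0 // /d; lra.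
have /andP[iN Ni] := truncn_itv (le_trans ler01 N1).
set i := Num.truncn N in iN Ni.
have aLe : a%:R <= L / eps by rewrite ler_pdivlMr // mulrC ltW.
have a2 : 8 * a%:R ^+ 2 * (1 + L) <= T.
  apply: le_trans Hexp.
  have : a%:R ^+ 2 <= L ^+ 2 / eps ^+ 2.
    by rewrite -expr_div_n ler_sqr ?nnegrE // divr_ge0 // ltW.
  have V0 : 0 < (eps ^+ 2)^-1 by rewrite invr_gt0 exprn_gt0.
  set V := (eps ^+ 2)^-1 in V0 *; move=> H.
  apply: (@le_trans _ _ (8 * (L ^+ 2 * V) * (1 + L))).
    by rewrite ler_wpM2r ?ler_wpM2l //; lra.
  have -> : 8 * (L ^+ 2 * V) * (1 + L) = 8 * V * (L ^+ 2 * (1 + L)) by ring.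
  rewrite ler_wpM2l ?mulr_ge0 ?(ltW V0) // [leRHS]exprSr.
  rewrite ler_wpM2r //; first by lra.
  by rewrite ler_sqr ?nnegrE //; lra.
have a2N : 8 * a%:R ^+ 2 * N * (1 + L) <= n%:R.
  have -> : 8 * a%:R ^+ 2 * N * (1 + L) = N * (8 * a%:R ^+ 2 * (1 + L)) by ring.
  by rewrite -NT ler_wpM2l // (le_trans ler01).
have a2N' : 8 * a%:R ^+ 2 * N <= n%:R.
  apply: le_trans a2N.
  by rewrite ler_peMr ?mulr_ge0 ?sqr_ge0 ?(le_trans ler01) //; lra.
have aa : a%:R <= a%:R ^+ 2 :> R by rewrite expr2 ler_peMl.
have aaN : a%:R ^+ 2 <= a%:R ^+ 2 * N :> R by rewrite ler_peMr // sqr_ge0.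
have aiN : a%:R ^+ 2 * i%:R <= a%:R ^+ 2 * N :> R.
  by rewrite ler_wpM2l // sqr_ge0.
have aiN' : a%:R * i%:R <= a%:R ^+ 2 * i%:R :> R by rewrite ler_wpM2r.
apply: (@breaker_criterion _ _ _ _ i) => //.
- rewrite -(ler_nat R) -(addn1 a) !(natrD, natrM); apply: le_trans Hb.
  (* As [b] exceeds [a * q], hence [n / (1 + L)], it can pay for the order of [a ^ 2 * N] edges of a
     clique round. *)
  have naq : n%:R <= a%:R * q * (1 + L).
    have : q * L <= a%:R * (q * L) by rewrite ler_peMl // mulr_ge0 // ltW.
    rewrite -qE; lra.
  have L1 : 0 < 1 + L by lra.
  have := le_trans a2N naq; rewrite (ler_pM2r L1).
  have : 0 <= eps * (a%:R * q).
    exact: mulr_ge0 (ltW e0) (mulr_ge0 (ler0n _ _) (ltW q0)).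
  lra.
- rewrite -(ler_nat R) -(addn1 a) !(natrD, natrM); lra.
rewrite -(ler_nat R) -addn1 natrD natrD.
have := sum_divn_ge_ln R b i a0.
set S := (\sum_(l < i) _)%:R.
have v1 : 1 <= eps^-1 by rewrite invf_ge1.
have vexp : 8 * (eps^-1 * (1 + L)) <= T.
  apply: le_trans Hexp; rewrite -!mulrA ler_wpM2l // ler_pM //; try lra.
    by rewrite lef_pV2 ?posrE ?exprn_gt0 // expr2 ler_piMl // ltW.
  by rewrite exprS ler_peMr ?exprn_ege1 //; lra.
have vL : eps^-1 <= eps^-1 * (1 + L) by rewrite ler_peMr //; lra.
have lnT : d * L = ln T by rewrite expRK.
have lna : ln a.+1%:R <= d * L.
  rewrite lnT ler_ln ?posrE ?ltr0n // -natr1; apply: le_trans vexp.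
  rewrite mulrC in aLe; lra.
have lni : (1 - d) * L <= ln i.+1%:R.
  have -> : (1 - d) * L = ln N by rewrite expRK.
  by rewrite ler_ln ?posrE ?ltr0n ?expR_gt0 // ltW.
have iT : i%:R <= eps / 2 * n%:R.
  apply: le_trans iN _; rewrite -NT mulrCA ler_peMr ?(le_trans ler01) //.
  rewrite mulrC -ler_pdivrMr ?divr_gt0 // mul1r invf_div; apply: le_trans vexp.
  lra.
set x := b%:R / a%:R.
have xq : (1 + eps) * q <= x by rewrite ler_pdivlMr // ?ltr0n //; lra.
have xa : x * a%:R = b%:R by rewrite divfK // gt_eqF // ltr0n.
have x0 : 0 <= x by rewrite divr_ge0.
(* [(1 - 2 * d) * L] bounds [ln i.+1 - ln a.+1] from below. As [d = eps / 8], the left side is at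
   least [(1 + eps / 2) * n], and the excess pays for the loss [i <= eps / 2 * n]. *)
have main : (1 - 2 * d) * ((1 + eps) * n%:R) <= x * (a%:R + (1 - 2 * d) * L).
  apply: (@le_trans _ _ (x * ((1 - 2 * d) * (a%:R + L)))); last first.
    by rewrite ler_wpM2l // mulrDr lerD2r ler_piMl //; lra.
  rewrite -qE [leRHS]mulrCA; apply: ler_wpM2l; first by rewrite /d; lra.
  by rewrite mulrA ler_wpM2r // ltW.
have : x * (a%:R + (1 - 2 * d) * L) <= x * (a%:R + (ln i.+1%:R - ln a.+1%:R)).
  by rewrite ler_wpM2l //; lra.
have : 0 <= eps * n%:R * (1 - eps) by rewrite !mulr_ge0 ?subr_ge0 ?(ltW e0).
rewrite /d in main *; nra.
Qed.

(** * Threshold biases for large [n] *)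

Local Open Scope classical_set_scope.

(** Lowering [eps] to at most 1 strengthens both claims because [beta n] is nonnegative. *)
Lemma threshold_of_near (R : realType)
    (maker_wins breaker_wins : nat -> nat -> Prop) (beta : nat -> R) :
  (forall eps : R, 0 < eps -> eps <= 1 -> \forall n \near \oo,
     [/\ 0 <= beta n,
         forall b, b%:R <= (1 - eps) * beta n -> maker_wins n b &
         forall b, (1 + eps) * beta n <= b%:R -> breaker_wins n b]) ->
  asymptotically_optimal_threshold_bias maker_wins breaker_wins beta.
Proof.
move=> H eps e0; have m0 : 0 < Num.min eps 1 by rewrite lt_min e0 ltr01.
have m1 : Num.min eps 1 <= 1 by rewrite ge_min lexx orbT.
have me : Num.min eps 1 <= eps by rewrite ge_min lexx.
have [n0 _ Hn] := H _ m0 m1; exists n0 => n /Hn[b0 mw bw]; split=> b.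
  move=> _ bn; apply: mw; apply: le_trans bn _.
  by rewrite ler_wpM2r // lerB.
by move=> bn; apply: bw; apply: le_trans bn; rewrite ler_wpM2r // lerD2l.
Qed.

Lemma near_ln_ge (R : realType) (K : R) : \forall n \near \oo, K <= ln n%:R.
Proof.
exists (Num.truncn (expR K)).+1 => // n /= nK.
rewrite -(expRK K) ler_ln ?posrE ?expR_gt0 ?ltr0n ?(leq_trans _ nK) //.
have /andP[_ /ltW] := truncn_itv (ltW (expR_gt0 K)).
by move/le_trans; apply; rewrite ler_nat.
Qed.

Lemma near_natr_ge (R : realType) (K : R) : \forall n \near \oo, K <= n%:R.
Proof.
have [N _ HN] := near_ln_ge K; exists N.+1 => // n /= Nn.
apply: le_trans (HN n (ltnW Nn)) _; apply/ltW/ln_sublinear.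
by rewrite ltr0n (leq_trans _ Nn).
Qed.

Lemma near_cube_le_expR (R : realType) (C d : R) : 0 <= C -> 0 < d ->
  \forall n \near \oo, C * (1 + ln n%:R) ^+ 3 <= expR (d * ln n%:R).
Proof.
move=> C0 d0.
(* [192 = 8 * 4!]: the 8 comes from [(1 + L) ^ 3 <= (2 * L) ^ 3], the factorial from the
   fourth-order term of the exponential. *)
have [N _ HN] := near_ln_ge (1 + 192 * C / d ^+ 4); exists N => // n /HN.
set L := ln _ => LK.
have d4 : 0 < d ^+ 4 by rewrite exprn_gt0.
have q0 : 0 <= 192 * C / d ^+ 4 by rewrite divr_ge0 ?mulr_ge0 // ltW.
have L1 : 1 <= L by lra.
have CL : 192 * C <= L * d ^+ 4 by rewrite -ler_pdivrMr //; lra.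
have L0 : 0 <= L by lra.
have := @expR_ge1Dxn R (d * L) 3 (mulr_ge0 (ltW d0) L0).
apply: le_trans; rewrite (_ : 4`! = 24)%N // exprMn.
apply: (@le_trans _ _ (8 * C * L ^+ 3)).
  have : (1 + L) ^+ 3 <= (2 * L) ^+ 3 by rewrite lerXn2r ?nnegrE //; lra.
  by move/(ler_wpM2l C0); rewrite exprMn; lra.
have L3 : 0 <= L ^+ 3 by rewrite exprn_ge0.
have := ler_wpM2r L3 CL; rewrite [L ^+ 4]exprS; lra.
Qed.

Lemma littleo_natr (R : realType) (f : nat -> nat) (g : nat -> R) (e : R) :
  (fun n => (f n)%:R : R^o) =o_\oo (fun n => g n : R^o) -> 0 < e ->
  \forall n \near \oo, (f n)%:R <= e * `|g n|.
Proof.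
move=> /eqoP fg e0; have [N _ HN] := fg e e0; exists N => // n /HN /=.
by rewrite ger0_norm.
Qed.

(** Here [s = a + ln n]; the terms [2 * k] and [4 / e] take at most [e / 8 * ln n] each. *)
Lemma threshold_log_degree (R : realType) (a k : nat -> nat)
    (a_gt0 : forall n, (0 < a n)%N) (k_gt0 : forall n, (0 < k n)%N) :
  (fun n => (k n)%:R : R^o) =o_\oo (fun n => ln n%:R : R^o) ->
  min_degree_threshold_bias a k
    (fun n => (a n)%:R * n%:R / ((a n)%:R + ln n%:R) : R).
Proof.
move=> ko; apply: threshold_of_near => e e0 e1.
have e16 : 0 < e / 16 by rewrite divr_gt0.
have kL := littleo_natr ko e16.
have e28 : 0 <= 8 / e ^+ 2 by rewrite divr_ge0 ?sqr_ge0.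
have e8 : 0 < e / 8 by rewrite divr_gt0.
near=> n.
have n0 : (0 < n)%N by near: n; exists 1%N.
have nR : 0 < n%:R :> R by rewrite ltr0n.
have aR : 0 < (a n)%:R :> R by rewrite ltr0n.
set L := ln n%:R.
have L0 : 0 <= L by rewrite ln_ge0 // ler1n.
have aL0 : 0 < (a n)%:R + L by rewrite ltr_wpDr.
have kLn : (k n)%:R <= e / 16 * L.
  rewrite -[in leRHS](ger0_norm L0) /L; near: n; exact: kL.
have eL : 4 / e <= e / 8 * L.
  rewrite [leRHS]mulrC -ler_pdivrMr // /L; near: n; exact: near_ln_ge.
have Ln : L <= n%:R by apply/ltW/ln_sublinear.
(* With [kLn] this bounds the constant 1 in the last condition of [maker_asymptotic] by
   [e / 16 * L]. *)
have k1 : 1 <= (k n)%:R :> R by rewrite ler1n.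
split.
- by rewrite divr_ge0 ?mulr_ge0 // ltW.
- move=> b Hb; apply: (@maker_asymptotic R _ _ _ _ e ((a n)%:R + L)) => //.
  + have := mulr_ge0 (ltW e0) (ltW aR).
    rewrite -/L; lra.
  + rewrite mulrAC ler_pdivrMr // -ler_pdivlMr //; apply: le_trans Hb _.
    by rewrite le_eqVlt; apply/orP; left; apply/eqP; ring.
  + have := ler_wpM2l (ltW e8) Ln; lra.
move=> b; apply: breaker_asymptotic => //.
by near: n; exact: near_cube_le_expR.
Unshelve. all: by end_near. Qed.

(** Here [s = a]: as [sqrt (n / ln n)] outgrows [ln n], the logarithm is negligible against [a]. A
    Breaker bias of at least [n] takes a whole star. *)
Lemma threshold_large_maker_bias (R : realType) (a k : nat -> nat)
    (a_gt0 : forall n, (0 < a n)%N) (k_gt0 : forall n, (0 < k n)%N) :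
  (fun n => (a n)%:R : R^o) =Omega_\oo
    (fun n => Num.sqrt (n%:R / ln n%:R) : R^o) ->
  (fun n => (k n)%:R : R^o) =o_\oo (fun n => (a n)%:R : R^o) ->
  (fun n => (k n)%:R : R^o) =o_\oo (fun n => n%:R : R^o) ->
  min_degree_threshold_bias a k (fun n => n%:R : R).
Proof.
rewrite eqOmegaE qualifE => /asboolP[c c0 aO] koa kon.
apply: threshold_of_near => e e0 e1.
have e8 : 0 < e / 8 by rewrite divr_gt0.
have e16 : 0 < e / 16 by rewrite divr_gt0.
have ka := littleo_natr koa e16.
have kn := littleo_natr kon e8.
(* Chosen so that [C * L ^ 3 <= n] gives [16 / (e * c) * L <= sqrt (n / L)], hence
   [2 * L <= e / 8 * a]. *)
pose C := (16 / (e * c)) ^+ 2.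
near=> n.
have n0 : (0 < n)%N by near: n; exists 1%N.
have nR : 0 < n%:R :> R by rewrite ltr0n.
pose L : R := ln n%:R.
have L1 : 1 <= L by rewrite /L; near: n; exact: near_ln_ge.
have kan : (k n)%:R <= e / 16 * (a n)%:R.
  by rewrite -[in leRHS](ger0_norm (ler0n R (a n))); near: n; exact: ka.
have knn : (k n)%:R <= e / 8 * n%:R.
  by rewrite -[in leRHS](ger0_norm (ltW nR)); near: n; exact: kn.
have an : c * Num.sqrt (n%:R / L) <= (a n)%:R.
  rewrite -[leRHS]ger0_norm // -[X in c * X]ger0_norm ?sqrtr_ge0 // /L.
  by near: n; exact: aO.
have eL : 4 / e <= L by rewrite /L; near: n; exact: near_ln_ge.
have en : 1 + 4 / e <= e / 8 * n%:R.
  rewrite [leRHS]mulrC -ler_pdivrMr //; near: n; exact: near_natr_ge.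
have Cn : C * (1 + L) ^+ 3 <= n%:R.
  rewrite -[leRHS]lnK ?posrE // -[ln n%:R]mul1r /L; near: n.
  by apply: near_cube_le_expR => //; rewrite sqr_ge0.
have L0 : 0 < L by lra.
have La : 2 * L <= e / 8 * (a n)%:R.
  apply: (@le_trans _ _ (e / 8 * (c * Num.sqrt (n%:R / L)))); last first.
    by rewrite ler_wpM2l // ltW.
  have ec : 0 < e * c by rewrite mulr_gt0.
  have : 16 / (e * c) * L <= Num.sqrt (n%:R / L).
    have x0 : 0 <= 16 / (e * c) * L.
      by apply: mulr_ge0 (ltW L0); rewrite divr_ge0 // ltW.
    rewrite -(ger0_norm x0) -sqrtr_sqr ler_wsqrtr // exprMn -/C.
    rewrite ler_pdivlMr //; apply: le_trans Cn.
    rewrite -mulrA -exprSr ler_wpM2l ?sqr_ge0 // lerXn2r ?nnegrE //; lra.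
  move/(ler_wpM2l (ltW ec)); rewrite mulrA mulrCA divff ?gt_eqF // mulr1; lra.
split=> //.
- move=> b Hb; apply: (@maker_asymptotic R _ _ _ _ e (a n)%:R) => //.
  + rewrite -/L; lra.
  + by rewrite divfK // gt_eqF // ltr0n.
  + lra.
move=> b Hb; apply: breaker_criterion_star => //.
apply: leq_trans (leq_pred n) _; rewrite -(ler_nat R); apply: le_trans Hb.
by rewrite mulrDl mul1r lerDl mulr_ge0 // ltW.
Unshelve. all: by end_near. Qed.

Theorem theorem14 (R : realType) (a k : nat -> nat)
    (a_gt0 : forall n, (0 < a n)%N) (k_gt0 : forall n, (0 < k n)%N) :
  ((fun n => (a n)%:R : R^o) =o_\oo
     (fun n => Num.sqrt (n%:R / ln n%:R) : R^o) ->
   (fun n => (k n)%:R : R^o) =o_\oo (fun n => ln n%:R : R^o) ->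
   min_degree_threshold_bias a k
     (fun n => (a n)%:R * n%:R / ((a n)%:R + ln n%:R) : R))
  /\
  ((fun n => (a n)%:R : R^o) =Omega_\oo
     (fun n => Num.sqrt (n%:R / ln n%:R) : R^o) ->
   (fun n => (k n)%:R : R^o) =o_\oo (fun n => (a n)%:R : R^o) ->
   (fun n => (k n)%:R : R^o) =o_\oo (fun n => n%:R : R^o) ->
   min_degree_threshold_bias a k (fun n => n%:R : R)).
Proof.
split=> [_|]; first exact: threshold_log_degree.
exact: threshold_large_maker_bias.
Qed.
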